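(* For every positive integer $n$, $\mathrm{BTP}(n)$ equals the set of all real triangular arrays $(b_{i,n-j})_{1\le j\le i\le n-1}$ such that $0\le b_{i,n-j}\le 1$ for all $1\le j\le i\le n-1$ and $$1+\sum_{k=j+1}^{i}b_{k,n-j-1}\ge\sum_{k=j}^{i}b_{k,n-j}\quad\text{for all }1\le j<i\le n-1.$$
   Context: A TSSCPP boolean triangle of order $n$ is a triangular array $(b_{i,n-j})_{1\le j\le i\le n-1}$ (so $\binom{n}{2}$ entries) with entries in $\{0,1\}$ such that for all $1\le j<i\le n-1$, $$1+\sum_{k=j+1}^{i}b_{k,n-j-1}\ge\sum_{k=j}^{i}b_{k,n-j}.$$ $\mathrm{BTP}(n)$ is the convex hull in $\mathbb{R}^{\binom{n}{2}}$ (coordinates indexed by the positions $(i,n-j)$, $1\le j\le i\le n-1$) of all TSSCPP boolean triangles of order $n$. *)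

(* Defs.v *)
From mathcomp Require Import all_boot all_order all_algebra.
From mathcomp Require Import classical_sets reals convex.

Set Implicit Arguments.
Unset Strict Implicit.
Unset Printing Implicit Defensive.

Import Order.TTheory GRing.Theory Num.Theory.

Local Open Scope classical_set_scope.
Local Open Scope ring_scope.

(* The position (i, n - j) is stored as the pair (i, m) with m = n - j; so
   the condition below reads 1 <= j <= i, and i <= n - 1 is part of 'I_n. *)
Definition tri_pos (n : nat) : Type :=
  {p : 'I_n * 'I_n | (1 <= n - p.2)%N && (n - p.2 <= p.1)%N}.

Definition tri_row (n : nat) (p : tri_pos n) : nat := (val p).1.
Definition tri_col (n : nat) (p : tri_pos n) : nat := (val p).2.

Definition tri_array (R : realType) (n : nat) : lmodType R :=
  {ffun tri_pos n -> R^o}.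

(* The junk value 0, taken when (i, m) is not a position, is never used below:
   see tri_entryE and tri_pos_ex. *)
Definition tri_entry (R : realType) (n : nat) (b : tri_array R n)
    (i m : nat) : R :=
  if [pick p : tri_pos n | (tri_row p == i) && (tri_col p == m)] is Some p
  then b p else 0.

Definition tsscpp_ineqs (R : realType) (n : nat) (b : tri_array R n) : Prop :=
  forall i j : nat, (1 <= j)%N -> (j < i)%N -> (i <= n - 1)%N ->
    1 + \sum_(j.+1 <= k < i.+1) tri_entry b k (n - j - 1)
      >= \sum_(j <= k < i.+1) tri_entry b k (n - j).

Definition tsscpp_boolean_triangle (R : realType) (n : nat) :
    set (tri_array R n) :=
  [set b : tri_array R n |
    (forall i j : nat, (1 <= j)%N -> (j <= i)%N -> (i <= n - 1)%N ->
       tri_entry b i (n - j) = 0 \/ tri_entry b i (n - j) = 1)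
    /\ tsscpp_ineqs b].
Arguments tsscpp_boolean_triangle : clear implicits.

Definition convex_hull (R : realType) (M : lmodType R) (A : set M) : set M :=
  smallest (@convex_set R M) A.

Definition BTP (R : realType) (n : nat) : set (tri_array R n) :=
  convex_hull (tsscpp_boolean_triangle R n).
Arguments BTP : clear implicits.

Lemma tri_entryE (R : realType) (n : nat) (b : tri_array R n) (p : tri_pos n) :
  tri_entry b (tri_row p) (tri_col p) = b p.
Proof.
rewrite /tri_entry; case: pickP => [q /andP[/eqP qi /eqP qm]|/(_ p)].
  congr (b _); apply: val_inj; rewrite [val q]surjective_pairing.
  by rewrite [val p]surjective_pairing; congr (_, _); apply: ord_inj.
by rewrite !eqxx.
Qed.

Lemma tri_pos_ex (n i j : nat) :
  (1 <= j)%N -> (j <= i)%N -> (i <= n - 1)%N ->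
  exists p : tri_pos n, tri_row p = i /\ tri_col p = (n - j)%N.
Proof.
move=> j0 ji iN.
have n0 : (0 < n)%N.
  by case: n iN => // /(leq_trans (leq_trans j0 ji)).
have ltin : (i < n)%N by rewrite -(subnK n0) addn1 ltnS.
have ltmn : (n - j < n)%N by rewrite ltn_subrL j0.
have jn : (j <= n)%N by apply: leq_trans ji (ltnW ltin).
have P : (1 <= n - (Ordinal ltin, Ordinal ltmn).2)%N &&
         (n - (Ordinal ltin, Ordinal ltmn).2 <= (Ordinal ltin, Ordinal ltmn).1)%N.
  by rewrite /= subKn // j0 ji.
by exists (exist _ (Ordinal ltin, Ordinal ltmn) P).
Qed.

Lemma card_tri_pos (n : nat) : #|{: tri_pos n}| = 'C(n, 2).
Proof.
rewrite card_sig -sum1_card -(pair_big_dep xpredT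
  (fun i m : 'I_n => (1 <= n - m)%N && (n - m <= i)%N) (fun _ _ => 1%N)) /=.
rewrite -bin2_sum big_mkord; apply: eq_bigr => i _.
rewrite (reindex_inj rev_ord_inj) /= sum1_card.
rewrite -[RHS]card_ord -[RHS](card_image (f := widen_ord (ltnW (ltn_ord i)))).
  apply: eq_card => m; rewrite unfold_in /= subKn ?ltn_ord //=.
  apply/idP/fintype.imageP => [mi|[k _ ->]]; last by rewrite /= ltn_ord.
  by exists (Ordinal mi) => //; apply: val_inj.
by move=> x y /(congr1 val) /= /val_inj.
Qed.

(* Main.v *)
(* In terms of the partial column sums S(i,j) = b_{j,n-j} + ... + b_{i,n-j} and
   S(j-1,j) = 0, all the inequalities bound a difference of two variables by an
   integer: 0 <= S(i,j) - S(i-1,j) <= 1 and S(i,j) - S(i,j+1) <= 1.  Such bounds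
   survive the rounding S |-> ceil (S - t), and so does the value 0 when
   0 <= t < 1; hence rounding turns a point of the polytope into a boolean
   triangle.  As t ranges uniformly over [0, 1[ the average of ceil (S - t) is S,
   and finitely many values of t, suitably weighted, already give this average
   for all the column sums at once. *)

Require Import Defs.
From mathcomp Require Import all_boot all_order all_algebra.
From mathcomp Require Import classical_sets reals.
From mathcomp Require Import interval_inference convex zify lra.

Import Order.TTheory GRing.Theory Num.Theory.

Local Open Scope classical_set_scope.
Local Open Scope ring_scope.

(** * Finite weighted sums in convex sets *)

Lemma convex_set_avg (R : realFieldType) (M : lmodType R)
    (A : set (convex_lmodType M)) (l : R) (x y : M) :
  convex_set A -> 0 <= l -> l <= 1 -> A x -> A y ->
  A (l *: x + (1 - l) *: y).
Proof.
move=> cA l0 l1 /mem_set xA /mem_set yA; apply: set_mem.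
have l01 : 0 <= l <= 1 by rewrite l0 l1.
exact: (cA x y (Itv01 l0 l1) xA yA).
Qed.

(** Leaving the total weight arbitrary lets the induction on [m] go through, since an initial
    segment of weights need not sum to 1. The point [a0] serves when the total is 0 and cannot be
    divided by. *)
Lemma convex_set_scaled_sum (R : realFieldType) (M : lmodType R)
    (A : set (convex_lmodType M)) (m : nat) (w : nat -> R) (g : nat -> M)
    (a0 : M) :
  convex_set A -> A a0 ->
  (forall k, (k < m)%N -> 0 <= w k) -> (forall k, (k < m)%N -> A (g k)) ->
  exists2 a, A a & \sum_(k < m) w k *: g k = (\sum_(k < m) w k) *: a.
Proof.
move=> cA Aa0; elim: m => [|m IHm] w0 gA.
  by exists a0 => //; rewrite !big_ord0 scale0r.
have [||a Aa eq_a] := IHm.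
- by move=> k km; apply/w0/ltnW.
- by move=> k km; apply/gA/ltnW.
rewrite !big_ord_recr /= eq_a; set W := \sum_(k < m) w k.
have W0 : 0 <= W by apply: sumr_ge0 => k _; apply/w0/ltnW/ltn_ord.
have wm0 : 0 <= w m by apply: w0.
have [Ww0|Ww_neq0] := eqVneq (W + w m) 0.
  have [-> ->] : W = 0 /\ w m = 0 by split; lra.
  by exists a0; rewrite // addr0 !scale0r addr0.
have Ww_gt0 : 0 < W + w m by rewrite lt_def Ww_neq0 addr_ge0.
exists ((W / (W + w m)) *: a + (1 - W / (W + w m)) *: g m).
  apply: convex_set_avg => //; last exact: gA.
  - by rewrite divr_ge0 // ltW.
  - by rewrite ler_pdivrMr // mul1r lerDl.
rewrite scalerDr !scalerA mulrBr mulr1 mulrCA mulfV // mulr1.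
by congr (_ + _ *: _); rewrite addrAC subrr add0r.
Qed.

Lemma convex_set_sum (R : realFieldType) (M : lmodType R)
    (A : set (convex_lmodType M)) (m : nat) (w : nat -> R) (g : nat -> M) :
  convex_set A -> \sum_(k < m) w k = 1 ->
  (forall k, (k < m)%N -> 0 <= w k) -> (forall k, (k < m)%N -> A (g k)) ->
  A (\sum_(k < m) w k *: g k).
Proof.
case: m => [|m] cA w1 w0 gA.
  by move/eqP: w1; rewrite big_ord0 eq_sym oner_eq0.
have Ag0 : A (g 0%N) by exact: gA.
have [a Aa ->] := @convex_set_scaled_sum _ _ A m.+1 w g (g 0%N) cA Ag0 w0 gA.
by rewrite w1 scale1r.
Qed.

(** * Averaging shifted ceilings *)

Lemma ceil_oppr_unit (R : realType) (t : R) :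
  0 <= t -> t < 1 -> Num.ceil (- t) = 0.
Proof.
by move=> t0 t1; apply: ceil_def; rewrite rmorphB /=; apply/andP; split; lra.
Qed.

Lemma ceil_sub_threshold (R : realType) (x t : R) : 0 <= t -> t < 1 ->
  Num.ceil (x - t) = Num.floor x + (t < x - (Num.floor x)%:~R).
Proof.
move=> t0 t1; apply: ceil_def.
have /andP[fl fu] := floor_itv x; rewrite rmorphD /= in fu.
rewrite !rmorphB !rmorphD /=.
by have [tf|ft] := ltP t; rewrite /= ?mulr0z ?mulr1z; apply/andP; split; lra.
Qed.

(* The thresholds are 0 and the sorted fractional parts of X; each carries as
   weight its distance to the next one (the last one, its distance to 1), so
   that the weights of the thresholds below a fractional part f sum to f. *)
Lemma threshold_average (R : realType) (X : seq R) :
  exists (m : nat) (w t : nat -> R),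
    [/\ forall k, (k < m)%N -> 0 <= w k,
        \sum_(k < m) w k = 1,
        forall k, (k < m)%N -> 0 <= t k /\ t k < 1 &
        forall x, x \in X -> \sum_(k < m) w k * (Num.ceil (x - t k))%:~R = x].
Proof.
pose frac (x : R) := x - (Num.floor x)%:~R.
have frac0 x : 0 <= frac x by rewrite /frac subr_ge0 floor_le.
have frac1 x : frac x < 1.
  by have /andP[_] := floor_itv x; rewrite rmorphD /= /frac ltrBlDl.
pose T := 0 :: sort <=%R [seq frac x | x <- X].
have Tsorted : sorted <=%R T.
  rewrite /= path_min_sorted ?sort_le_sorted //.
  by apply/allP => u; rewrite mem_sort => /mapP[x _ ->].
have T01 u : u \in T -> 0 <= u /\ u < 1.
  by rewrite inE mem_sort => /predU1P[->|/mapP[x _ ->]].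
(* The default value 1 acts as a final threshold just past the list, closing the last interval. *)
pose t : nat -> R := nth 1 T.
have t01 k : (k < size T)%N -> 0 <= t k /\ t k < 1.
  by move=> kT; apply: T01; apply: mem_nth.
have t_end : t (size T) = 1 by rewrite /t nth_default.
have t_mono i j : (i <= j)%N -> (j < size T)%N -> t i <= t j.
  move=> ij jT; apply: (sorted_leq_nth le_trans le_refl) => //.
  by rewrite inE (leq_ltn_trans ij).
have t_step k : (k < size T)%N -> t k <= t k.+1.
  rewrite leq_eqVlt => /predU1P[Tk|kT]; last exact: t_mono.
  by rewrite Tk t_end; have [|_ /ltW] := t01 k; rewrite -?Tk.
have telescope (F : nat -> R) :
    \sum_(k < size T) (F k.+1 - F k) = F (size T) - F 0%N.
  by rewrite -(big_mkord xpredT (fun k => F k.+1 - F k)) telescope_sumr.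
exists (size T), (fun k => t k.+1 - t k), t; split=> //.
- by move=> k /t_step; rewrite subr_ge0.
- by rewrite telescope t_end subr0.
move=> x xX; have fT : frac x \in T by rewrite inE mem_sort map_f ?orbT.
under eq_bigr => k _.
  have [tk0 tk1] := t01 k (ltn_ord k).
  rewrite ceil_sub_threshold // rmorphD /= mulrDr -/(frac x).
  (* Written as an increment of [Num.min _ (frac x)], the weight counted below [frac x]
     telescopes. *)
  have -> : (t k.+1 - t k) * (t k < frac x)%R%:Z%:~R =
            Num.min (t k.+1) (frac x) - Num.min (t k) (frac x).
    case: ltP => [tkf|ftk]; last first.
      rewrite mulr0z mulr0 min_r ?subrr //.
      exact: le_trans ftk (t_step _ (ltn_ord k)).
    rewrite mulr1z mulr1 min_l //; move: tkf.
    (* No threshold interval straddles [frac x], which is itself a threshold: [t k < frac x] forces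
       [k] below its index, hence [t k.+1 <= frac x]. *)
    move: fT; rewrite -index_mem => jT.
    have <- : t (index (frac x) T) = frac x.
      by rewrite /t nth_index // -index_mem.
    move=> tkf; apply: (t_mono) => //; rewrite ltnNge; apply/negP => jk.
    by move: tkf; rewrite ltNge t_mono.
  over.
rewrite big_split /= -mulr_suml telescope (telescope (fun k => Num.min (t k) _)).
rewrite t_end subr0 mul1r min_r ?(ltW (frac1 x)) // min_l ?frac0 //.
by rewrite subr0 addrC subrK.
Qed.

(** * Triangles, their column sums and rounding *)

Lemma tri_entry_combination (R : realType) (n m : nat) (w : nat -> R)
    (g : nat -> tri_array R n) (i c : nat) :
  tri_entry (\sum_(k < m) w k *: g k) i c =
  \sum_(k < m) w k * tri_entry (g k) i c.
Proof.
rewrite /tri_entry; case: pickP => [p _|_]; last first.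
  by rewrite big1 // => k _; rewrite mulr0.
by rewrite sum_ffunE; apply: eq_bigr => k _; rewrite ffunE.
Qed.

Lemma tri_entry_avg (R : realType) (n : nat) (l l' : R) (x y : tri_array R n)
    (i c : nat) :
  tri_entry (l *: x + l' *: y) i c = l * tri_entry x i c + l' * tri_entry y i c.
Proof.
rewrite /tri_entry; case: pickP => [p _|_]; last by rewrite !mulr0 addr0.
by rewrite !ffunE.
Qed.

Lemma tri_pos_index (n : nat) (p : tri_pos n) : exists i j : nat,
  [/\ (1 <= j)%N, (j <= i)%N, (i <= n - 1)%N,
      tri_row p = i & tri_col p = (n - j)%N].
Proof.
have /andP[p1 p2] := valP p; exists (tri_row p), (n - tri_col p)%N; split=> //.
- by rewrite -ltnS subn1 prednK ?ltn_ord // (leq_ltn_trans _ (ltn_ord (val p).1)).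
- by rewrite subKn // ltnW // ltn_ord.
Qed.

(* Off by one: [col_sum b i j] is S(i-1,j). *)
Definition col_sum {R : realType} {n : nat} (b : tri_array R n) (i j : nat) : R :=
  \sum_(j <= k < i) tri_entry b k (n - j).

(** Entries are chosen so that the column sums of the new array are the rounded column sums of [b];
    [n - tri_col p] recovers the index [j]. *)
Definition round_tri {R : realType} {n : nat} (b : tri_array R n) (t : R) :
    tri_array R n :=
  [ffun p : tri_pos n =>
    (Num.ceil (col_sum b (tri_row p).+1 (n - tri_col p) - t))%:~R -
    (Num.ceil (col_sum b (tri_row p) (n - tri_col p) - t))%:~R].

Section Rounding.
Context {R : realType} {n : nat} (b : tri_array R n).

Lemma round_triE (t : R) (i j : nat) :
  (1 <= j)%N -> (j <= i)%N -> (i <= n - 1)%N ->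
  tri_entry (round_tri b t) i (n - j) =
  (Num.ceil (col_sum b i.+1 j - t))%:~R - (Num.ceil (col_sum b i j - t))%:~R.
Proof.
move=> j1 ji iN; have [p [pi pj]] := @tri_pos_ex n i j j1 ji iN.
rewrite -{1}pi -pj tri_entryE ffunE pi pj subKn //.
by rewrite (leq_trans ji) // (leq_trans iN) // leq_subr.
Qed.

Lemma col_sumS (i j : nat) : (j <= i)%N ->
  col_sum b i.+1 j = col_sum b i j + tri_entry b i (n - j).
Proof. by move=> ji; rewrite /col_sum big_nat_recr. Qed.

Lemma col_sum_diag (j : nat) : col_sum b j j = 0.
Proof. by rewrite /col_sum big_geq. Qed.

(** The sum telescopes, and its lower end is the ceiling of [- t], which is 0. The value [i = n] is
    allowed because only rows below [i] are summed. *)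
Lemma col_sum_round_tri (t : R) (i j : nat) : 0 <= t -> t < 1 ->
  (1 <= j)%N -> (j <= i)%N -> (i <= n)%N ->
  col_sum (round_tri b t) i j = (Num.ceil (col_sum b i j - t))%:~R.
Proof.
move=> t0 t1 j1 ji iN; rewrite /col_sum.
rewrite (eq_big_nat _ _ (F2 := fun k => (Num.ceil (col_sum b k.+1 j - t))%:~R -
    (Num.ceil (col_sum b k j - t))%:~R)).
  by rewrite telescope_sumr // col_sum_diag sub0r ceil_oppr_unit // subr0.
move=> k /andP[jk ki]; apply: round_triE => //.
by rewrite -ltnS subn1 prednK ?(leq_trans ki) // (leq_trans _ (leq_trans ki iN)).
Qed.

Lemma round_tri_boolean (t : R) : 0 <= t -> t < 1 ->
  (forall i j : nat, (1 <= j)%N -> (j <= i)%N -> (i <= n - 1)%N ->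
     0 <= tri_entry b i (n - j) /\ tri_entry b i (n - j) <= 1) ->
  tsscpp_ineqs b -> tsscpp_boolean_triangle R n (round_tri b t).
Proof.
move=> t0 t1 b01 bI.
have lt_n i : (0 < i)%N -> (i <= n - 1)%N -> (i.+1 <= n)%N.
  move=> i0 iN; rewrite -(@ltn_predK 0 n) ?ltnS -?subn1 //.
  by rewrite lt0n; apply: contraTneq iN => ->; rewrite -ltnNge.
split=> [i j j1 ji iN|i j j1 ji iN].
  rewrite round_triE // col_sumS //; have [b0 b1] := b01 i j j1 ji iN.
  set c := col_sum b i j; set e := tri_entry b i (n - j) in b0 b1 *.
  have lo : Num.ceil (c - t) <= Num.ceil (c + e - t) by apply: le_ceil; lra.
  have hi : Num.ceil (c + e - t) <= Num.ceil (c - t) + 1.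
    by rewrite -[1](@ceil1 R) -ceilDrz //; apply: le_ceil; lra.
  rewrite -rmorphB /=.
  (* An integer between 0 and 1 is one of the two. *)
  have : Num.ceil (c + e - t) - Num.ceil (c - t) \in [:: 0; 1].
    by rewrite !inE; lia.
  by rewrite !inE => /orP[]/eqP ->; [left|right].
have i0 : (0 < i)%N by apply: leq_trans ji.
(* With [n - j - 1] read as [n - j.+1], both sides become column sums up to row [i], of columns [j]
   and [j.+1]. *)
have := bI i j j1 ji iN; rewrite -subnDA addn1.
rewrite -!/(col_sum _ _ _) !col_sum_round_tri ?lt_n //; last first.
- exact/leqW/ltnW.
- exact: ltnW.
move=> le_cols; rewrite -[1](mulr1z 1) -rmorphD /= ler_int.
rewrite -[1](@ceil1 R) -ceilDzr //.
by apply: le_ceil; lra.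
Qed.

End Rounding.

Theorem theorem5p3 (R : realType) (n : nat) (hn : (1 <= n)%N) :
  BTP R n =
  [set b : tri_array R n |
    (forall i j : nat, (1 <= j)%N -> (j <= i)%N -> (i <= n - 1)%N ->
       0 <= tri_entry b i (n - j) /\ tri_entry b i (n - j) <= 1)
    /\ (forall i j : nat, (1 <= j)%N -> (j < i)%N -> (i <= n - 1)%N ->
          1 + \sum_(j.+1 <= k < i.+1) tri_entry b k (n - j - 1)
            >= \sum_(j <= k < i.+1) tri_entry b k (n - j))].
Proof.
apply/seteqP; split.
  (* The hull is the smallest convex set containing the boolean triangles, so it suffices that the
     polytope is convex and contains them. *)
  apply: smallest_sub.
    move=> x y l /set_mem[x01 xI] /set_mem[y01 yI]; apply/mem_set.
    have l0 : 0 <= l%:num :> R by [].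
    have l1 : l%:num <= 1 :> R by [].
    change (conv l x y) with
      (l%:num *: (x : tri_array R n) + (1 - l%:num) *: (y : tri_array R n)).
    move: l%:num l0 l1 => L L0 L1; split=> i j j1 ji iN.
      have [x0 x1] := x01 i j j1 ji iN; have [y0 y1] := y01 i j j1 ji iN.
      by rewrite tri_entry_avg; split; nra.
    have := xI i j j1 ji iN; have := yI i j j1 ji iN.
    under [in X in _ -> _ -> X <= _]eq_bigr do rewrite tri_entry_avg.
    under [in X in _ -> _ -> _ <= X]eq_bigr do rewrite tri_entry_avg.
    by rewrite !big_split /= -!mulr_sumr => Hy Hx; nra.
  move=> b [b01 bI]; split=> // i j j1 ji iN.
  by case: (b01 i j j1 ji iN) => ->; rewrite ?lexx ?ler01.
move=> b [b01 bI] A [cA triA].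
(* One family of thresholds must average all column sums simultaneously, so that their differences,
   the entries of [b], are averaged too. *)
pose X := [seq col_sum b i j | i <- iota 0 n.+1, j <- iota 0 n.+1].
have [m [w [t [w0 w1 t01 avg]]]] := threshold_average R X.
have -> : b = \sum_(k < m) w k *: round_tri b (t k).
  apply/ffunP => p; rewrite -[RHS]tri_entryE -[LHS]tri_entryE.
  rewrite (@tri_entry_combination R n m w (fun k => round_tri b (t k))).
  have [i [j [j1 ji iN -> ->]]] := tri_pos_index n p.
  have iltn : (i < n)%N by rewrite -(@ltn_predK 0 n) // ltnS -subn1.
  have memX k : (k <= n)%N -> col_sum b k j \in X.
    move=> kn; apply/allpairsP; exists (k, j).
    by rewrite !mem_iota /= !add0n !ltnS kn (leq_trans ji (ltnW iltn)).
  under eq_bigr do rewrite round_triE // mulrBr.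
  rewrite sumrB !avg ?memX // ?(ltnW iltn) //.
  by rewrite col_sumS // addrC addKr.
apply: (@convex_set_sum _ _ A m w (fun k => round_tri b (t k))) => // k km; apply: triA.
by have [t0 t1] := t01 k km; apply: round_tri_boolean.
Qed.
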